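(* For all integers $\ell>1$, $n>0$, $m>0$ and $r\ge 0$ we have \[S_{m,r}^n(\ell)=\sum_{i=0}^{n+1}\ell^i\left(\sum_{k=0}^n\frac{m^k\,W_{m,r}(n,k)}{k+1}\,S_1(k+1,i)\right).\]
   Context: For integers $m,r$, a positive integer $n$ and a positive integer $\ell$, the power sum of an arithmetic progression is \[S_{m,r}^n(\ell)=r^n+(m+r)^n+(2m+r)^n+\cdots+((\ell-1)m+r)^n=\sum_{x=0}^{\ell-1}(mx+r)^n .\] $S_1(n,k)$ denotes the signed Stirling numbers of the first kind, i.e. $x^{\underline{n}}=x(x-1)\cdots(x-n+1)=\sum_{k=0}^{n}S_1(n,k)x^k$, with $S_1(n,k)=0$ for $k>n$. $W_{m,r}(n,k)$ denotes the $r$-Whitney numbers of the second kind, defined for $k\ge 0$ by the exponential generating function \[\sum_{n=k}^\infty W_{m,r}(n,k)\frac{z^n}{n!}=\frac{e^{rz}}{k!}\left(\frac{e^{mz}-1}{m}\right)^k .\] *)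

(* Defs.v *)
From HB Require Import structures.
From mathcomp Require Import all_boot all_order all_algebra.

Set Implicit Arguments.
Unset Strict Implicit.
Unset Printing Implicit Defensive.

Import Order.TTheory GRing.Theory Num.Theory.
Local Open Scope ring_scope.

Definition power_sum (m r : int) (n l : nat) : int :=
  \sum_(0 <= x < l) (m * x%:Z + r) ^+ n.

Definition falling_poly (n : nat) : {poly int} :=
  \prod_(0 <= i < n) ('X - (i%:Z)%:P).

Definition stirling1 (n k : nat) : int := (falling_poly n)`_k.

(* A formal power series over rat is represented by its coefficient sequence,
   [f n] being the coefficient of z ^ n. *)
Definition fps := nat -> rat.

Definition fps1 : fps := fun n => (n == 0%N)%:R.

Definition fps_sub (f g : fps) : fps := fun n => f n - g n.

Definition fps_scale (a : rat) (f : fps) : fps := fun n => a * f n.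

Definition fps_mul (f g : fps) : fps :=
  fun n => \sum_(i < n.+1) f i * g (n - i)%N.

Definition fps_pow (f : fps) (k : nat) : fps := iter k (fps_mul f) fps1.

(* The series e ^ (a z). *)
Definition fps_expz (a : rat) : fps := fun n => a ^+ n / (n`!)%:R.

(* e ^ (r z) / k! * ((e ^ (m z) - 1) / m) ^ k; meaningful for m != 0. *)
Definition whitney2_gf (m r : int) (k : nat) : fps :=
  fps_mul (fps_scale (k`!)%:R^-1 (fps_expz r%:~R))
    (fps_pow (fps_scale m%:~R^-1 (fps_sub (fps_expz m%:~R) fps1)) k).

Definition whitney2 (m r : int) (n k : nat) : rat :=
  (n`!)%:R * whitney2_gf m r k n.

Lemma fps_pow_lt (f : fps) (k n : nat) :
  f 0%N = 0 -> (n < k)%N -> fps_pow f k n = 0.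
Proof.
move=> f0; elim: k n => // k IHk n lt_nk.
rewrite /fps_pow iterS /fps_mul big1 // => -[[|i] /= lt_in] _.
  by rewrite f0 mul0r.
rewrite [iter _ _ _ _]IHk ?mulr0 //.
by case: n lt_nk lt_in => // n lt_nk lt_in; rewrite subSS (leq_ltn_trans (leq_subr _ _)).
Qed.

(* The exponential generating function, whose sum starts at n = k. *)
Lemma whitney2_egf (m r : int) (k n : nat) :
  (if (k <= n)%N then whitney2 m r n k / (n`!)%:R else 0) = whitney2_gf m r k n.
Proof.
case: leqP => [_|lt_nk].
  by rewrite /whitney2 mulrC mulKf // pnatr_eq0 -lt0n fact_gt0.
rewrite /whitney2_gf /fps_mul big1 // => i _.
rewrite fps_pow_lt ?mulr0 ?(leq_ltn_trans (leq_subr _ _)) //.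
by rewrite /fps_scale /fps_sub /fps_expz /fps1 expr0 fact0 divr1 subrr mulr0.
Qed.

(* Main.v *)
Require Import Defs.
From HB Require Import structures.
From mathcomp Require Import all_boot all_order all_algebra.

Set Implicit Arguments.
Unset Strict Implicit.
Unset Printing Implicit Defensive.

Import Order.TTheory GRing.Theory Num.Theory.
Local Open Scope ring_scope.

(** Put [u = e ^ (m z) - 1].  The denominators [k!] and [m ^ k] in the generating
    function of the Whitney numbers are there so that
    [m ^ k * k! * W(n, k) = n! [z ^ n] (e ^ (r z) * u ^ k)].
    Expanding [e ^ (m x z) = (1 + u) ^ x] by the binomial theorem and
    multiplying by [e ^ (r z)] therefore gives, on comparing the coefficients
    of [z ^ n], the expansion of a power in binomial coefficients
    [(m x + r) ^ n = \sum_k m ^ k * k! * W(n, k) * 'C(x, k)]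
    ([expr_arith_whitney2]); the sum stops at [k = n] because [u ^ k] has
    order [k].  Summing over [x < l] replaces ['C(x, k)] by ['C(l, k.+1)]
    ([sum_bin_upper]), which is the falling factorial of [l] with [k.+1]
    factors divided by [(k.+1)!]; the Stirling numbers of the first kind expand
    that falling factorial in powers of [l] ([sum_stirling1]), and
    [k! / (k.+1)!] leaves the denominator [k.+1]. *)

(** * Formal power series *)

Lemma fps_mulBl1 (f g : fps) (n : nat) :
  fps_mul (fps_sub f fps1) g n = fps_mul f g n - g n.
Proof.
rewrite /fps_mul /fps_sub /fps1.
under eq_bigr do rewrite mulrBl.
rewrite sumrB; congr (_ - _).
rewrite big_ord_recl /= mul1r subn0 big1 ?addr0 // => i _.
by rewrite mul0r.
Qed.

Lemma fps_mul_sumr (f : fps) (N : nat) (c : nat -> rat) (g : nat -> fps)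
    (n : nat) :
  fps_mul f (fun j => \sum_(k < N) c k * g k j) n =
  \sum_(k < N) c k * fps_mul f (g k) n.
Proof.
rewrite /fps_mul.
under eq_bigr do rewrite mulr_sumr.
rewrite exchange_big; apply: eq_bigr => k _ /=.
by rewrite mulr_sumr; apply: eq_bigr => i _; rewrite mulrCA.
Qed.

Lemma fps_pow_scale (a : rat) (f : fps) (k n : nat) :
  fps_pow (fps_scale a f) k n = a ^+ k * fps_pow f k n.
Proof.
elim: k n => [|k IHk] n; first by rewrite mul1r.
rewrite /fps_pow !iterS /fps_mul mulr_sumr; apply: eq_bigr => i _.
by rewrite [iter k _ _ _]IHk /fps_scale exprS mulrACA.
Qed.

(** The binomial expansion of [f ^ x = (1 + (f - 1)) ^ x].  When the constant
    term of [f] is 1, [(f - 1) ^ k] has order at least [k], so any bound [N]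
    beyond [n] captures the whole coefficient of [z ^ n], uniformly in [x];
    this is why the bound is on the side of [n] rather than the usual
    [k <= x]. *)
Lemma fps_pow_binomial (f : fps) (N x n : nat) :
  f 0%N = 1 -> (n < N)%N ->
  \sum_(k < N) 'C(x, k)%:R * fps_pow (fps_sub f fps1) k n = fps_pow f x n.
Proof.
move=> f0; case: N => // N; set u := fps_sub f fps1.
have u0 : u 0%N = 0 by rewrite /u /fps_sub f0 subrr.
elim: x n => [|x IHx] n lt_nN.
  by rewrite big_ord_recl bin0 mul1r big1 ?addr0 // => k _; rewrite mul0r.
have -> : fps_pow f x.+1 n = fps_pow f x n + fps_mul u (fps_pow f x) n.
  by rewrite fps_mulBl1 addrC subrK.
have -> : fps_mul u (fps_pow f x) n =
          \sum_(k < N.+1) 'C(x, k)%:R * fps_pow u k.+1 n.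
  rewrite -(@fps_mul_sumr u N.+1 (fun k => 'C(x, k)%:R) (fps_pow u)).
  rewrite /fps_mul; apply: eq_bigr => i _.
  by rewrite IHx // (leq_ltn_trans (leq_subr _ _)).
(* The top term vanishes because u ^ N.+1 has order N.+1. *)
have -> : \sum_(k < N.+1) 'C(x, k)%:R * fps_pow u k.+1 n =
          \sum_(k < N) 'C(x, k)%:R * fps_pow u k.+1 n.
  by rewrite big_ord_recr /= [fps_mul u _ n](fps_pow_lt u0 lt_nN) mulr0 addr0.
rewrite -IHx // 2!big_ord_recl !bin0 -addrA.
congr (_ + _); rewrite -big_split; apply: eq_bigr => k _.
by rewrite binS natrD mulrDl.
Qed.

(** Comparing coefficients, this is the binomial formula for [(a + b) ^ n]. *)
Lemma fps_mul_expz (a b : rat) :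
  fps_mul (fps_expz a) (fps_expz b) =1 fps_expz (a + b).
Proof.
move=> n; rewrite /fps_mul /fps_expz addrC exprDn mulr_suml.
apply: eq_bigr => i _; have le_in : (i <= n)%N by rewrite -ltnS.
have bin_div : 'C(n, i)%:R / (n`!)%:R = (i`!)%:R^-1 * ((n - i)`!)%:R^-1 :> rat.
  rewrite -(bin_fact le_in) natrM invfM mulrA divff ?mul1r ?natrM ?invfM //.
  by rewrite pnatr_eq0 -lt0n bin_gt0.
by rewrite -[_ *+ 'C(n, i)]mulr_natr -[RHS]mulrA bin_div mulrACA [b ^+ _ * _]mulrC.
Qed.

Lemma fps_pow_expz (a : rat) (x : nat) :
  fps_pow (fps_expz a) x =1 fps_expz (a * x%:R).
Proof.
elim: x => [|x IHx] n.
  rewrite mulr0 /fps_expz expr0n /fps_pow /= /fps1.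
  by case: n => [|n]; rewrite ?divr1 ?mul0r.
rewrite -natr1 mulrDr mulr1 addrC -fps_mul_expz.
by rewrite /fps_pow iterS; apply: eq_bigr => i _; rewrite [iter x _ _ _]IHx.
Qed.

(** * Whitney numbers of the second kind *)

Lemma whitney2_scaled (m r : int) (n k : nat) : m != 0 ->
  m%:~R ^+ k * whitney2 m r n k * (k`!)%:R =
  (n`!)%:R * fps_mul (fps_expz r%:~R)
    (fps_pow (fps_sub (fps_expz m%:~R) fps1) k) n.
Proof.
move=> m_neq0; rewrite /whitney2 mulrCA -mulrA; congr (_ * _).
have mk_neq0 : m%:~R ^+ k != 0 :> rat by rewrite expf_neq0 // intr_eq0.
have fk_neq0 : (k`!)%:R != 0 :> rat by rewrite pnatr_eq0 -lt0n fact_gt0.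
rewrite /whitney2_gf /fps_mul mulrAC mulr_sumr; apply: eq_bigr => i _.
rewrite fps_pow_scale /fps_scale exprVn [m%:~R ^+ k * _]mulrC mulrACA.
by rewrite !mulVKf.
Qed.

(** The coefficient of [z ^ n] in
    [e ^ ((m x + r) z) = e ^ (r z) * (1 + (e ^ (m z) - 1)) ^ x]. *)
Lemma expr_arith_whitney2 (m r : int) (n x : nat) : m != 0 ->
  ((m * x%:Z + r) ^+ n)%:~R =
  \sum_(k < n.+1) m%:~R ^+ k * whitney2 m r n k * (k`!)%:R * 'C(x, k)%:R :> rat.
Proof.
move=> m_neq0; set u := fps_sub (fps_expz m%:~R) fps1.
under eq_bigr do rewrite whitney2_scaled // mulrAC -mulrA.
rewrite -mulr_sumr.
rewrite -(@fps_mul_sumr _ n.+1 (fun k => 'C(x, k)%:R) (fps_pow u)).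
have -> : fps_mul (fps_expz r%:~R)
            (fun j => \sum_(k < n.+1) 'C(x, k)%:R * fps_pow u k j) n =
          fps_expz (r%:~R + m%:~R * x%:R) n.
  rewrite -fps_mul_expz; apply: eq_bigr => i _.
  by rewrite fps_pow_binomial ?ltnS ?leq_subr ?fps_pow_expz.
rewrite /fps_expz [RHS]mulrC divfK; last by rewrite pnatr_eq0 -lt0n fact_gt0.
by rewrite rmorphXn rmorphD rmorphM addrC.
Qed.

(** * Falling factorials *)

Lemma sum_bin_upper (l k : nat) : (\sum_(x < l) 'C(x, k) = 'C(l, k.+1))%N.
Proof.
elim: l => [|l IHl]; first by rewrite big_ord0.
by rewrite big_ord_recr /= IHl binS.
Qed.

Lemma size_falling_poly (k : nat) : size (falling_poly k) = k.+1.
Proof. by rewrite /falling_poly size_prod_XsubC size_iota subn0. Qed.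

Lemma horner_falling_poly (k l : nat) : (falling_poly k).[l%:Z] = (l ^_ k)%:Z.
Proof.
rewrite /falling_poly horner_prod; elim: k => [|k IHk].
  by rewrite big_geq.
rewrite big_nat_recr //= IHk hornerXsubC ffactnSr PoszM.
case: (leqP k l) => [le_kl|lt_lk]; first by rewrite subzn.
(* When l < k the factors l - k differ, but both products already vanish. *)
by rewrite ffact_small // !mul0r.
Qed.

(** Both sides are the falling factorial of [l] with [k] factors. *)
Lemma sum_stirling1 (k l N : nat) : (k < N)%N ->
  \sum_(i < N) l%:R ^+ i * (stirling1 k i)%:~R = ('C(l, k) * k`!)%:R :> rat.
Proof.
move=> lt_kN; have le_size : (size (falling_poly k) <= N)%N.
  by rewrite size_falling_poly.
rewrite bin_ffact [RHS]pmulrn -horner_falling_poly (horner_coef_wide _ le_size).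
rewrite rmorph_sum; apply: eq_bigr => i _.
by rewrite rmorphM rmorphXn mulrC.
Qed.

(** * Power sums of arithmetic progressions *)

Theorem theorem1 (l n : nat) (m r : int)
    (hl : (1 < l)%N) (hn : (0 < n)%N) (hm : 0 < m) (hr : 0 <= r) :
  (power_sum m r n l)%:~R =
  \sum_(0 <= i < n.+2)
     l%:R ^+ i *
     (\sum_(0 <= k < n.+1)
        m%:~R ^+ k * whitney2 m r n k / k.+1%:R * (stirling1 k.+1 i)%:~R) :> rat.
Proof.
have m_neq0 : m != 0 by rewrite gt_eqF.
rewrite /power_sum rmorph_sum !big_mkord.
transitivity (\sum_(k < n.+1) m%:~R ^+ k * whitney2 m r n k * (k`!)%:R *
                'C(l, k.+1)%:R : rat).
  rewrite (eq_bigr _ (fun x _ => expr_arith_whitney2 r n (nat_of_ord x) m_neq0)).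
  rewrite exchange_big; apply: eq_bigr => k _ /=.
  by rewrite -mulr_sumr -natr_sum sum_bin_upper.
under [RHS]eq_bigr do rewrite big_mkord mulr_sumr.
rewrite exchange_big; apply: eq_bigr => k _ /=.
under eq_bigr do rewrite mulrCA.
rewrite -mulr_sumr sum_stirling1; last by rewrite ltnS ltn_ord.
rewrite factS !natrM -[LHS]mulrA -[RHS]mulrA; congr (_ * _).
by rewrite ['C(_, _)%:R * (_ * _)]mulrCA mulKf ?pnatr_eq0 // mulrC.
Qed.
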